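(* There exist absolute constants $\kappa,C>0$ such that for all positive integers $p,m$ there is an event of probability larger than $1-C/p$ on which $$\forall k,\ell\in\{0,\dots,p-1\},\qquad \big|(\tilde G-I_p)_{k,\ell}\big|\le \xi:=\kappa\left(\frac{\log p}{\sqrt p}+\frac{\log^2p}{m}\right),$$ and, on the same event, $$\|\tilde Ax\|_2\ \ge\ \|x\|_2-\sqrt{\xi}\,\|x\|_1\qquad\text{for all }x\in\mathbb{R}^p .$$
   Context: $U_1,\dots,U_m$ are i.i.d. uniform on $\{0,\dots,p-1\}$; for $k\in\mathbb{Z}$, $\mathbb{N}(k)=\mathrm{card}\{i:U_i\equiv k\bmod p\}$; $A\in\mathbb{R}^{p\times p}$ (rows and columns indexed by $\{0,\dots,p-1\}$) is the circulant matrix $A_{\ell,k}=\mathbb{N}(\ell-k)$. With $\mathbf 1\in\mathbb{R}^p$ the all-ones vector, $$\tilde A=\frac1{\sqrt m}A-\frac{\sqrt m-1}{p}\mathbf 1\mathbf 1^\top,\qquad \tilde G=\tilde A^\top\tilde A .$$ *)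

(* Defs.v *)
(* MathComp / MathComp-Analysis *)
From HB Require Import structures.
From mathcomp Require Import all_boot all_order all_algebra.
From mathcomp Require Import all_classical all_reals all_analysis.

Set Implicit Arguments.
Unset Strict Implicit.
Unset Printing Implicit Defensive.

Import Order.TTheory GRing.Theory Num.Theory.
Import numFieldNormedType.Exports.

Local Open Scope classical_set_scope.
Local Open Scope ring_scope.

Definition mutually_independent (R : realType) (d d' : measure_display)
    (T : measurableType d) (T' : measurableType d') (P : probability T R)
    (I : finType) (X : I -> {RV P >-> T'}) : Prop :=
  forall (J : {set I}) (B : I -> set T'),
    (forall i, measurable (B i)) ->
    P (\bigcap_(i in [set` J]) (X i @^-1` B i))
      = (\prod_(i in J) P (X i @^-1` B i))%E.

(* The random variables are nat-valued, so that their codomain carries the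
   library's discrete sigma-algebra; the law, not the type, confines them to
   {0, ..., p-1}. *)
Definition uniform_residue (R : realType) (d : measure_display)
    (T : measurableType d) (P : probability T R) (p : nat)
    (X : {RV P >-> nat}) : Prop :=
  forall k : nat,
    P (X @^-1` [set k]) = (if (k < p)%N then (p%:R)^-1 else 0)%:E.

(* For u = (U_1(t), ..., U_m(t)), the number of i with U_i(t) = k mod p. *)
Definition residue_count (p m : nat) (u : 'I_m -> nat) (k : int) : nat :=
  #|[pred i : 'I_m | ((u i)%:Z == k %[mod p%:Z])%Z]|.

Definition circulantA (R : realType) (p m : nat) (u : 'I_m -> nat) :
    'M[R]_p :=
  \matrix_(l < p, k < p) (residue_count p u (l%:Z - k%:Z))%:R.

Definition ones (R : realType) (p : nat) : 'cV[R]_p := const_mx 1.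

Definition tildeA (R : realType) (p m : nat) (u : 'I_m -> nat) : 'M[R]_p :=
  (Num.sqrt m%:R)^-1 *: circulantA R p u
  - ((Num.sqrt m%:R - 1) / p%:R) *: (ones R p *m (ones R p)^T).

Definition tildeG (R : realType) (p m : nat) (u : 'I_m -> nat) : 'M[R]_p :=
  (tildeA R p u)^T *m tildeA R p u.

(* The library's norm on matrices is the sup norm. *)
Definition l1norm (R : realType) (p : nat) (x : 'cV[R]_p) : R :=
  \sum_(i < p) `|x i ord0|.

Definition l2norm (R : realType) (p : nat) (x : 'cV[R]_p) : R :=
  Num.sqrt (\sum_(i < p) x i ord0 ^+ 2).

Definition xi (R : realType) (kappa : R) (p m : nat) : R :=
  kappa * (ln p%:R / Num.sqrt p%:R + ln p%:R ^+ 2 / m%:R).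

(* Main.v *)
Require Import Defs.
From HB Require Import structures.
From mathcomp Require Import all_boot all_order all_algebra.
From mathcomp Require Import all_classical all_reals all_analysis.
From mathcomp Require Import ring lra.
Import Order.TTheory GRing.Theory Num.Theory.
Import numFieldNormedType.Exports.
Local Open Scope classical_set_scope.
Local Open Scope ring_scope.

(** Write [g z = N(z) - m/p] for the centred occurrence counts.  Since [g] has
    sum 0, expanding [tildeA] shows that the [(k, l)] entry of [tildeG - I] is
    [S(k - l) / m], where
    [S(d) = sum_z g(z) g(z + d) - m (1_{d = 0} - 1/p)]
    is the sum over ordered pairs [i <> j] of [1_{U_j - U_i = d} - 1/p]: a
    degenerate U-statistic.  When the sample is revealed one term at a time, a
    new term [y] changes [g(z)] by [1_{y = z} - 1/p] and [S(d)] by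
    [g(y + d) + g(y - d)]; both increments average to 0 over [y], so that [g]
    and [S] are martingales, and the increments of [S] are small as long as
    [g] is small.

    Both facts are exploited at once by a single potential: the sum over [z],
    over [d] and over both signs of the compensated exponentials
    [exp (+-lam g(z) - n 2 lam^2/p)] and [exp (+-mu S(d) - n 2 mu^2 v)], where
    [n] is the current sample size.  It starts at [4 p].  As long as it stays
    below [p^2], every [|g(z)|] is at most [4 ln p / lam], hence the increments
    of [S] are controlled and the potential does not increase in mean
    ([potential_step]).  A backward induction on the number of remaining terms
    then shows that it ends above [p^2] for a proportion at most
    [4 p / p^2 = 4 / p] of the samples ([sum_potential_reaches_le]); for the
    others, the bound on [exp (+-mu S(d))] bounds all the [S(d)]
    simultaneously ([exists_potential]).  Independence and uniformity serve
    only to give each sample of residues the probability [p^-m]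
    ([probability_cylinder]).

    The constants are [kappa = 64] and [C = 5].  When [p < 5] the required
    probability is negative and the empty event suffices, so that [ln p > 0]
    can be assumed.

    The lower bound on [tildeA x] follows deterministically from the entrywise
    bound ([l2norm_mulmx_ge]). *)

Set Implicit Arguments.
Unset Strict Implicit.
Unset Printing Implicit Defensive.

(** * Exponential moments *)

(** From [exp (- x) >= 1 - x], as [(1 + x + 2 x^2) (1 - x) >= 1] when
    [x <= 1/2]. *)
Lemma expR_le_quadratic (R : realType) (x : R) :
  x <= 2^-1 -> expR x <= 1 + x + 2 * x ^+ 2.
Proof.
move=> hx.
have h1 : expR x * (1 - x) <= 1.
  rewrite -[leRHS](expRxMexpNx_1 x) ler_wpM2l ?expR_ge0 //.
  by rewrite expR_ge1Dx.
have h2 : 1 <= (1 + x + 2 * x ^+ 2) * (1 - x).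
  have -> : (1 + x + 2 * x ^+ 2) * (1 - x) = 1 + x ^+ 2 * (1 - 2 * x) by ring.
  by rewrite lerDl mulr_ge0 ?sqr_ge0 //; lra.
have h3 : 0 < 1 - x by lra.
by rewrite -(ler_pM2r h3); exact: le_trans h1 h2.
Qed.

(** The one-step Bernstein estimate: an average over [I] of [exp X], for [X]
    centred, of second moment at most [v], and bounded above. *)
Lemma sum_expR_le (R : realType) (I : finType) (X : I -> R) (v : R) :
  (forall i, X i <= 2^-1) -> \sum_i X i = 0 ->
  \sum_i X i ^+ 2 <= #|I|%:R * v ->
  \sum_i expR (X i) <= #|I|%:R * expR (2 * v).
Proof.
move=> X_le X0 X2.
apply: (@le_trans _ _ (\sum_i (1 + X i + 2 * X i ^+ 2))).
  by apply: ler_sum => i _; exact: expR_le_quadratic.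
rewrite !big_split /= X0 addr0 -mulr_sumr sumr_const.
apply: (@le_trans _ _ (#|I|%:R * (1 + 2 * v))).
  rewrite mulrDr mulr1 lerD2l mulrCA ler_wpM2l //.
by rewrite ler_wpM2l // expR_ge1Dx.
Qed.

(** * Samples on which a potential becomes large *)

Lemma sum_tuple_cons (R : nmodType) (T : finType) (n : nat) (F : seq T -> R) :
  \sum_(s : n.+1.-tuple T) F s
    = \sum_(y : T) \sum_(s : n.-tuple T) F (y :: s).
Proof.
rewrite pair_bigA /=.
rewrite (reindex (fun x : T * n.-tuple T => [tuple of x.1 :: x.2])) //=.
exists (fun t : n.+1.-tuple T => (thead t, [tuple of behead t])).
  by move=> [y s] _ /=; rewrite theadE; congr pair; apply/val_inj.
by move=> t _ /=; rewrite -tuple_eta.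
Qed.

(** Histories are lists whose head is the latest term, so that reading the
    tuple [s] after the history [h] leads to [catrev s h].  A potential that
    does not increase in mean while below [a] ends above [a] for a proportion
    at most [Z h / a] of the continuations.  The mean decrease is asked
    for only below [a], because from the level [a] on the trivial bound 1 on the
    proportion is already at most [Z h / a]. *)
Lemma sum_potential_reaches_le (R : realType) (T : finType) (m : nat)
    (Z : seq T -> R) (a : R) :
  0 <= a -> (forall h, 0 <= Z h) ->
  (forall h, (size h < m)%N -> Z h < a ->
     \sum_(y : T) Z (y :: h) <= #|T|%:R * Z h) ->
  forall n h, (size h + n <= m)%N ->
  a * \sum_(s : n.-tuple T) (a <= Z (catrev s h))%R%:R <= #|T|%:R ^+ n * Z h.
Proof.
move=> a_ge0 Z_ge0 Z_step; elim=> [|n IHn] h size_h.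
  rewrite (big_pred1 [tuple]) /=; last by move=> s; apply/esym/eqP; exact: tuple0.
  by rewrite expr0 mul1r; case: (lerP a (Z h)); rewrite ?mulr1 ?mulr0.
have [Zh_lt|Zh_ge] := ltP (Z h) a; last first.
  rewrite mulrC; apply: ler_pM => //; first by rewrite sumr_ge0.
  rewrite -natrX -card_tuple -sum1_card natr_sum.
  by apply: ler_sum => s _; case: (a <= _).
rewrite (@sum_tuple_cons _ _ _ (fun s => (a <= Z (catrev s h))%R%:R)) mulr_sumr.
apply: (@le_trans _ _ (\sum_(y : T) #|T|%:R ^+ n * Z (y :: h))).
  by apply: ler_sum => y _; apply: IHn; rewrite /= addSnnS.
rewrite -mulr_sumr exprSr -mulrA ler_wpM2l ?exprn_ge0 //.
apply: Z_step => //; apply: leq_trans size_h.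
by rewrite addnS ltnS leq_addr.
Qed.

(** * Occurrence counts and pair counts as martingales *)

Section Deviations.
Context (R : realType) (G : finZmodType).
Implicit Types (h : seq G) (y z d : G).
Local Notation p := (#|G|%:R : R).

Definition dev h z : R := (count_mem z h)%:R - (size h)%:R / p.

(** The deviation from its mean of the number of ordered pairs of distinct
    positions of [h] whose entries differ by [d].  The correlation of [dev] with
    its shift by [d] counts all pairs of positions; the subtracted term is the
    contribution of the diagonal. *)
Definition pairdev h d : R :=
  \sum_z dev h z * dev h (z + d) - (size h)%:R * ((d == 0)%:R - p^-1).

Lemma card_zmod_gt0 : 0 < p.
Proof. by rewrite ltr0n; apply/card_gt0P; exists 0; rewrite inE. Qed.

Lemma sum_cst (c : R) : \sum_(z : G) c = p * c.
Proof. by rewrite sumr_const mulr_natl. Qed.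

Lemma sum_indicator (f : G -> R) y : \sum_z (y == z)%:R * f z = f y.
Proof.
rewrite (bigD1 y) //= eqxx mul1r big1 ?addr0 // => z /negbTE.
by rewrite eq_sym => ->; rewrite mul0r.
Qed.

Lemma dev_cons y h z : dev (y :: h) z = dev h z + ((y == z)%:R - p^-1).
Proof. by rewrite /dev /= natrD -natr1; ring. Qed.

Lemma sum_count h : \sum_z (count_mem z h)%:R = (size h)%:R :> R.
Proof.
elim: h => [|y h IHh] /=; first by rewrite big1.
under eq_bigr do rewrite natrD.
rewrite big_split /= IHh -natr1 addrC; congr (_ + _).
by rewrite -[RHS](sum_indicator (fun=> 1) y); under [RHS]eq_bigr do rewrite mulr1.
Qed.

Lemma sum_dev h : \sum_z dev h z = 0.
Proof.
rewrite sumrB sum_count sum_cst.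
by rewrite mulrCA divff ?mulr1 ?subrr ?gt_eqF ?card_zmod_gt0.
Qed.

Lemma sum_norm_dev h : \sum_z `|dev h z| <= 2 * (size h)%:R.
Proof.
apply: (@le_trans _ _ (\sum_z ((count_mem z h)%:R + (size h)%:R / p))).
  apply: ler_sum => z _; apply: le_trans (ler_normB _ _) _.
  by rewrite !ger0_norm // divr_ge0.
rewrite big_split /= sum_count sum_cst.
by rewrite mulrCA divff ?gt_eqF ?card_zmod_gt0 // mulr1; lra.
Qed.

Lemma sum_shift (f : G -> R) d : \sum_z f (z + d) = \sum_z f z.
Proof. by rewrite [RHS](reindex_inj (addIr d)). Qed.

(** The cross terms of the correlation give the increment; the square of the
    new indicator cancels against the new diagonal term. *)
Lemma pairdev_cons y h d :
  pairdev (y :: h) d = pairdev h d + (dev h (y + d) + dev h (y - d)).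
Proof.
rewrite /pairdev /= -natr1.
have -> : \sum_z dev (y :: h) z * dev (y :: h) (z + d)
    = \sum_z dev h z * dev h (z + d)
      + (\sum_z (y == z)%:R * dev h (z + d) - p^-1 * \sum_z dev h (z + d))
      + (\sum_z (y == z + d)%:R * dev h z - p^-1 * \sum_z dev h z)
      + (\sum_z (y == z)%:R * ((y == z + d)%:R - p^-1)
         - p^-1 * \sum_z ((y == z + d)%:R - p^-1)).
  rewrite !mulr_sumr -!sumrB -!big_split /=; apply: eq_bigr => z _.
  by rewrite !dev_cons; ring.
rewrite sum_shift sum_dev !sum_indicator.
have -> : \sum_z (y == z + d)%:R * dev h z = dev h (y - d).
  by rewrite -[RHS]sum_indicator; apply: eq_bigr => z _; rewrite subr_eq.
have -> : \sum_z ((y == z + d)%:R - p^-1) = 0.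
  rewrite (sum_shift (fun z => (y == z)%:R - p^-1)) sumrB.
  rewrite -(eq_bigr _ (fun z _ => mulr1 (y == z)%:R)) sum_indicator sum_cst.
  by rewrite divff ?subrr ?gt_eqF ?card_zmod_gt0.
have -> : (y == y + d) = (d == 0).
  by rewrite -{1}[y]addr0 (inj_eq (addrI y)) eq_sym.
by ring.
Qed.


(** The subtracted terms compensate the growth of the exponentials: they add up
    the bounds given by [sum_expR_drift_le] for the successive increments, of
    second moment [lam ^+ 2 / p] and [mu ^+ 2 * v] at most. *)
Definition expdev (lam : R) h z : R :=
  expR (lam * dev h z - (size h)%:R * (2 * (lam ^+ 2 / p))).

Definition exppair (mu v : R) h d : R :=
  expR (mu * pairdev h d - (size h)%:R * (2 * (mu ^+ 2 * v))).

Lemma sum_expR_drift_le (X : G -> R) (x v w : R) :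
  (forall y, X y <= 2^-1) -> \sum_y X y = 0 -> \sum_y X y ^+ 2 <= p * v ->
  \sum_y expR (x + X y - (w + 2 * v)) <= p * expR (x - w).
Proof.
move=> X_le X0 X2.
rewrite (eq_bigr (fun y => expR (x - w) * expR (- (2 * v)) * expR (X y)));
  last by move=> y _; rewrite -!expRD; congr expR; ring.
have -> : p * expR (x - w)
    = expR (x - w) * expR (- (2 * v)) * (p * expR (2 * v)).
  by rewrite -mulrA [X in _ = _ * X]mulrCA -expRD addNr expR0 mulr1 mulrC.
rewrite -mulr_sumr ler_wpM2l ?mulr_ge0 ?expR_ge0 //.
exact: sum_expR_le.
Qed.

(** The indicator of [y = z] has variance at most [1/p] when [y] is uniform. *)
Lemma expdev_step (lam : R) h z : `|lam| <= 2^-1 ->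
  \sum_y expdev lam (y :: h) z <= p * expdev lam h z.
Proof.
move=> lam_le; have p_gt0 := card_zmod_gt0.
have p_ge1 : 1 <= p by rewrite ler1n -(ltr0n R).
have pV : p * p^-1 = 1 by rewrite divff ?gt_eqF.
have pV_gt0 : 0 < p^-1 by rewrite invr_gt0.
have pV_le1 : p^-1 <= 1 by rewrite invf_le1.
rewrite (eq_bigr (fun y => expR (lam * dev h z + lam * ((z == y)%:R - p^-1)
    - ((size h)%:R * (2 * (lam ^+ 2 / p)) + 2 * (lam ^+ 2 / p))))); last first.
  move=> y _; rewrite /expdev dev_cons /= -natr1 [y == z]eq_sym.
  by congr expR; ring.
apply: sum_expR_drift_le.
- move=> y; apply: le_trans (ler_norm _) _; rewrite normrM.
  rewrite -[leRHS]mulr1; apply: ler_pM => //.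
  by rewrite ler_norml; case: (z == y) => /=; rewrite ?mulr1n ?mulr0n; lra.
- rewrite -mulr_sumr sumrB sum_cst pV.
  rewrite -(eq_bigr _ (fun y _ => mulr1 (z == y)%:R)) sum_indicator.
  by rewrite subrr mulr0.
- have -> : \sum_y (lam * ((z == y)%:R - p^-1)) ^+ 2
      = lam ^+ 2 * \sum_y ((z == y)%:R * (1 - 2 * p^-1) + p^-1 ^+ 2).
    rewrite mulr_sumr; apply: eq_bigr => y _.
    by case: (z == y); rewrite ?mulr1n ?mulr0n; ring.
  have pV2 : p * p^-1 ^+ 2 = p^-1 by rewrite expr2 mulrA pV mul1r.
  rewrite big_split /= sum_indicator sum_cst pV2.
  rewrite [leRHS]mulrCA pV ler_wpM2l ?sqr_ge0 //; lra.
Qed.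

(** The increment [dev h (y + d) + dev h (y - d)] has second moment at most
    four times that of [dev h], whence the factor 4. *)
Lemma exppair_step (mu M w : R) h d :
  (forall z, `|dev h z| <= M) -> `|mu| * (2 * M) <= 2^-1 ->
  \sum_z dev h z ^+ 2 <= p * w ->
  \sum_y exppair mu (4 * w) (y :: h) d <= p * exppair mu (4 * w) h d.
Proof.
move=> dev_le muM dev2.
rewrite (eq_bigr (fun y => expR (mu * pairdev h d
      + mu * (dev h (y + d) + dev h (y - d))
    - ((size h)%:R * (2 * (mu ^+ 2 * (4 * w))) + 2 * (mu ^+ 2 * (4 * w))))));
  last first.
  move=> y _; rewrite /exppair pairdev_cons /= -natr1.
  by congr expR; ring.
apply: sum_expR_drift_le.
- move=> y; apply: le_trans (ler_norm _) _; rewrite normrM.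
  apply: le_trans muM; rewrite ler_wpM2l //.
  apply: le_trans (ler_normD _ _) _.
  by have := lerD (dev_le (y + d)) (dev_le (y - d)); lra.
- by rewrite -mulr_sumr big_split /= !(sum_shift (dev h)) sum_dev addr0 mulr0.
- apply: (@le_trans _ _
      (\sum_y 2 * mu ^+ 2 * (dev h (y + d) ^+ 2 + dev h (y - d) ^+ 2))).
    apply: ler_sum => y _; rewrite exprMn [2 * _]mulrC -[leRHS]mulrA ler_wpM2l ?sqr_ge0 //.
    by have := sqr_ge0 (dev h (y + d) - dev h (y - d)); rewrite !expr2; lra.
  rewrite -mulr_sumr big_split /= !(sum_shift (fun z => dev h z ^+ 2)).
  have := ler_wpM2l (sqr_ge0 mu) dev2; lra.
Qed.

Definition potential (lam mu v : R) h : R :=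
  \sum_z (expdev lam h z + expdev (- lam) h z
         + (exppair mu v h z + exppair (- mu) v h z)).

Lemma potential_nil (lam mu v : R) : potential lam mu v [::] = 4 * p.
Proof.
rewrite /potential (eq_bigr (fun=> 4)) ?sum_cst 1?mulrC // => z _.
have dev0 y : dev [::] y = 0 by rewrite /dev /= mul0r subrr.
have pairdev0 : pairdev [::] z = 0.
  by rewrite /pairdev mul0r subr0 big1 // => y _; rewrite dev0 mul0r.
by rewrite /expdev /exppair dev0 pairdev0 /= !mul0r !mulr0 subrr expR0; lra.
Qed.

Lemma potential_ge (lam mu v : R) h z :
  [/\ expdev lam h z <= potential lam mu v h,
      expdev (- lam) h z <= potential lam mu v h,
      exppair mu v h z <= potential lam mu v h
    & exppair (- mu) v h z <= potential lam mu v h].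
Proof.
have pot_ge : expdev lam h z + expdev (- lam) h z
    + (exppair mu v h z + exppair (- mu) v h z) <= potential lam mu v h.
  rewrite /potential (bigD1 z) //= lerDl sumr_ge0 // => y _.
  by rewrite !addr_ge0 // expR_ge0.
have := expR_ge0 (lam * dev h z - (size h)%:R * (2 * (lam ^+ 2 / p))).
have := expR_ge0 (- lam * dev h z - (size h)%:R * (2 * ((- lam) ^+ 2 / p))).
have := expR_ge0 (mu * pairdev h z - (size h)%:R * (2 * (mu ^+ 2 * v))).
have := expR_ge0 (- mu * pairdev h z - (size h)%:R * (2 * ((- mu) ^+ 2 * v))).
rewrite -/(expdev lam h z) -/(expdev (- lam) h z).
rewrite -/(exppair mu v h z) -/(exppair (- mu) v h z).
by split; lra.
Qed.

Lemma potential_step (lam mu M w : R) h :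
  `|lam| <= 2^-1 -> (forall z, `|dev h z| <= M) -> `|mu| * (2 * M) <= 2^-1 ->
  \sum_z dev h z ^+ 2 <= p * w ->
  \sum_y potential lam mu (4 * w) (y :: h) <= p * potential lam mu (4 * w) h.
Proof.
move=> lam_le dev_le muM dev2.
rewrite exchange_big /= mulr_sumr; apply: ler_sum => z _.
rewrite !big_split /= !mulrDr.
apply: lerD; apply: lerD.
- exact: expdev_step.
- by apply: expdev_step; rewrite normrN.
- exact: (@exppair_step _ M).
- by apply: (@exppair_step (- mu) M); rewrite ?normrN.
Qed.

Lemma tilted_norm_le (x c b L : R) : 0 < c ->
  expR (c * x - b) < expR (2 * L) -> expR (- c * x - b) < expR (2 * L) ->
  `|x| <= (b + 2 * L) / c.
Proof.
move=> c_gt0; rewrite !ltr_expR => xle xge.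
by rewrite ler_norml -mulNr ler_pdivrMr // ler_pdivlMr //; apply/andP; split; lra.
Qed.

Lemma dev_small (lam L : R) (m : nat) h z :
  0 < lam -> m%:R * lam ^+ 2 <= p * L -> (size h <= m)%N ->
  expdev lam h z < expR (2 * L) -> expdev (- lam) h z < expR (2 * L) ->
  `|dev h z| <= 4 * L / lam.
Proof.
rewrite /expdev sqrrN => lam_gt0 lam2 size_h hle hge.
apply: le_trans (tilted_norm_le lam_gt0 hle hge) _.
rewrite ler_wpM2r ?invr_ge0 ?(ltW lam_gt0) //.
suff : (size h)%:R * (lam ^+ 2 / p) <= L by lra.
rewrite mulrA ler_pdivrMr ?card_zmod_gt0 // [leRHS]mulrC.
apply: le_trans lam2.
by rewrite ler_wpM2r ?sqr_ge0 // ler_nat.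
Qed.

(** In both regimes the second moment of [dev h] is of order [m L / p].  When
    [lam = 1/2], i.e. for [m] small compared with [p L], one factor is bounded
    by [8 L] and the sum of the absolute values of the other by [2 m]; bounding
    both by [8 L] would be too lossy.  Otherwise the pointwise bound is already
    of the order of the square root of [m L / p]. *)
Lemma sum_sq_dev_le (lam L : R) (m : nat) h :
  0 < L -> lam = 2^-1 \/ m%:R * lam ^+ 2 = p * L -> 0 < lam ->
  (size h <= m)%N -> (forall z, `|dev h z| <= 4 * L / lam) ->
  \sum_z dev h z ^+ 2 <= p * (16 * (m%:R * L / p)).
Proof.
move=> L_gt0 lamE lam_gt0 size_h dev_le; have p_gt0 := card_zmod_gt0.
have -> : p * (16 * (m%:R * L / p)) = 16 * (m%:R * L).
  by field; rewrite gt_eqF.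
case: lamE => [lamE|lam2].
  rewrite lamE invrK in dev_le.
  apply: (@le_trans _ _ (\sum_z 4 * L * 2 * `|dev h z|)).
    apply: ler_sum => z _.
    by rewrite -real_normK ?num_real // expr2 ler_wpM2r.
  rewrite -mulr_sumr.
  have := le_trans (sum_norm_dev h) (ler_wpM2l _ (_ : (size h)%:R <= m%:R)).
  rewrite ler_nat => /(_ (ler0n _ _) size_h) hle.
  by have := ler_wpM2l (ltW L_gt0) hle; lra.
apply: (@le_trans _ _ (\sum_(z : G) (4 * L / lam) ^+ 2)).
  apply: ler_sum => z _.
  by rewrite -real_normK ?num_real // lerXn2r ?nnegrE ?(le_trans _ (dev_le z)).
rewrite sum_cst expr_div_n [leLHS]mulrA ler_pdivrMr ?exprn_gt0 //.
have -> : 16 * (m%:R * L) * lam ^+ 2 = 16 * L * (m%:R * lam ^+ 2) by ring.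
by rewrite lam2 le_eqVlt; apply/orP; left; apply/eqP; ring.
Qed.

(** The witness is the minimum of [1/2] and the square root of [p L / m], the
    value that balances the two terms of the tail bound for [dev]. *)
Lemma exists_tilt (m : nat) (L : R) : (0 < m)%N -> 0 < L ->
  exists lam : R, [/\ 0 < lam, lam <= 2^-1, m%:R * lam ^+ 2 <= p * L
    & lam = 2^-1 \/ m%:R * lam ^+ 2 = p * L].
Proof.
move=> m_gt0 L_gt0; have p_gt0 := card_zmod_gt0.
have mR_gt0 : 0 < m%:R :> R by rewrite ltr0n.
have [le_half|ge_half] := leP (p * L / m%:R) (2^-1 ^+ 2).
  exists (Num.sqrt (p * L / m%:R)).
  have pL_gt0 : 0 < p * L / m%:R by rewrite divr_gt0 ?mulr_gt0.
  have lam2 : m%:R * Num.sqrt (p * L / m%:R) ^+ 2 = p * L.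
    by rewrite sqr_sqrtr ?ltW // mulrC divfK ?gt_eqF.
  split; rewrite ?sqrtr_gt0 ?lam2 //; last by right.
  by rewrite -[leRHS]ger0_norm // -sqrtr_sqr ler_wsqrtr.
exists 2^-1; split => //; last by left.
by rewrite mulrC -ler_pdivlMr // ltW.
Qed.

Lemma pairdev_small (mu v L : R) (m : nat) h d :
  0 < mu -> 0 <= v -> (size h <= m)%N ->
  exppair mu v h d < expR (2 * L) -> exppair (- mu) v h d < expR (2 * L) ->
  `|pairdev h d| <= 2 * (m%:R * mu * v) + 2 * L / mu.
Proof.
rewrite /exppair sqrrN => mu_gt0 v_ge0 size_h hle hge.
apply: le_trans (tilted_norm_le mu_gt0 hle hge) _.
rewrite mulrDl lerD2r ler_pdivrMr //.
have -> : 2 * (m%:R * mu * v) * mu = m%:R * (2 * (mu ^+ 2 * v)) by ring.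
by rewrite ler_wpM2r ?ler_nat // mulr_ge0 // mulr_ge0 // sqr_ge0.
Qed.

(** The choice of [mu] is dictated by two requirements: the increments of
    [mu * pairdev] must be at most [1/2], which in the two regimes of
    [exists_tilt] asks for [1/mu] of order [L] or [m / sqrt p]; and the
    resulting bound [2 m mu v + 2 L / mu], with [v] of order [m L / p], must be
    of order [m L / sqrt p + L ^ 2].  The inverse of [32 L + 8 m / sqrt p]
    meets both. *)
Lemma exists_potential (m : nat) (L : R) : (0 < m)%N -> 0 < L ->
  exists lam mu v : R,
    (forall h, (size h < m)%N -> potential lam mu v h < expR (2 * L) ->
       \sum_y potential lam mu v (y :: h) <= p * potential lam mu v h) /\
    (forall h d, (size h <= m)%N -> potential lam mu v h < expR (2 * L) ->
       `|pairdev h d| <= 64 * (m%:R * (L / Num.sqrt p) + L ^+ 2)).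
Proof.
move=> m_gt0 L_gt0; have p_gt0 := card_zmod_gt0.
have mR_gt0 : 0 < m%:R :> R by rewrite ltr0n.
have [lam [lam_gt0 lam_le lam2 lamE]] := exists_tilt m_gt0 L_gt0.
pose r : R := Num.sqrt p.
have r_gt0 : 0 < r by rewrite sqrtr_gt0.
have r_ge1 : 1 <= r.
  by rewrite -sqrtr1 ler_wsqrtr // ler1n -(ltr0n R).
have pE : p = r ^+ 2 by rewrite sqr_sqrtr ?ltW.
pose B : R := 32 * L + 8 * (m%:R / r).
have mr_gt0 : 0 < m%:R / r by rewrite divr_gt0.
have B_gt0 : 0 < B by rewrite /B; lra.
have B_ge : 16 * (L / lam) <= B.
  case: lamE => [->|lamE].
    by rewrite invrK /B; lra.
  (* L / lam = lam * m / p, where lam <= 1/2 and p >= sqrt p. *)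
  have -> : L / lam = lam * (m%:R / r) / r.
    apply: (@mulIf _ (lam * r ^+ 2)); first by rewrite mulf_neq0 ?gt_eqF ?exprn_gt0.
    have -> : L / lam * (lam * r ^+ 2) = p * L.
      by rewrite pE; field; rewrite gt_eqF.
    by rewrite -lamE; field; rewrite gt_eqF.
  suff : lam * (m%:R / r) / r <= 2^-1 * (m%:R / r) by rewrite /B; lra.
  rewrite ler_pdivrMr //; apply: (@le_trans _ _ (2^-1 * (m%:R / r))).
    by rewrite ler_wpM2r // ltW.
  by rewrite ler_peMr // mulr_ge0 // ltW.
pose w : R := 16 * (m%:R * L / p).
have w_ge0 : 0 <= w by rewrite /w !mulr_ge0 ?invr_ge0 // ltW.
exists lam, B^-1, (4 * w); split => [h size_h pot_lt | h d size_h pot_lt].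
  have dev_le z : `|dev h z| <= 4 * L / lam.
    have [? ? _ _] := potential_ge lam B^-1 (4 * w) h z.
    by apply: (dev_small lam_gt0 lam2 (ltnW size_h)); apply: le_lt_trans pot_lt.
  apply: (potential_step _ dev_le).
  - by rewrite ger0_norm // ltW.
  - rewrite ger0_norm ?invr_ge0 ?(ltW B_gt0) // mulrC ler_pdivrMr //.
    by move: B_ge; lra.
  - exact: (sum_sq_dev_le L_gt0 lamE lam_gt0 (ltnW size_h) dev_le).
have [_ _ ple nle] := potential_ge lam B^-1 (4 * w) h d.
have muB_gt0 : 0 < B^-1 by rewrite invr_gt0.
have := pairdev_small muB_gt0 _ size_h (le_lt_trans ple pot_lt)
  (le_lt_trans nle pot_lt).
rewrite invrK mulr_ge0 // => /(_ isT) pd_le; apply: le_trans pd_le _.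
have mLr_ge0 : 0 <= m%:R * (L / r) by rewrite mulr_ge0 ?divr_ge0 // ltW.
suff h8 : m%:R * B^-1 * (4 * w) <= 8 * (m%:R * (L / r)).
  have : L * B = 32 * L ^+ 2 + 8 * (m%:R * (L / r)) by rewrite /B; ring.
  by move: h8; rewrite -/r; lra.
have -> : m%:R * B^-1 * (4 * w) = 8 * (m%:R / r) / B * (8 * (m%:R * (L / r))).
  by rewrite /w pE; field; rewrite !gt_eqF.
rewrite ler_piMl //; first by rewrite !mulr_ge0 ?invr_ge0 // ltW.
by rewrite ler_pdivrMr // mul1r /B lerDr mulr_ge0 // ltW.
Qed.

End Deviations.
(** * Most samples have small pair deviations *)

Lemma pairdev_perm (R : realType) (G : finZmodType) (h1 h2 : seq G) (d : G) :
  perm_eq h1 h2 -> pairdev R h1 d = pairdev R h2 d.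
Proof.
move=> h12; have devE z : dev R h1 z = dev R h2 z.
  by rewrite /dev (permP h12) (perm_size h12).
rewrite /pairdev (perm_size h12); congr (_ - _).
by apply: eq_bigr => z _; rewrite !devE.
Qed.

Lemma most_tuples_small_pairdev (R : realType) (G : finZmodType) (m : nat) :
  (0 < m)%N -> (1 < #|G|)%N ->
  exists good : pred (m.-tuple G),
    (forall s : m.-tuple G, good s -> forall d : G,
       `|pairdev R s d| <= 64 * (m%:R * (ln #|G|%:R / Num.sqrt #|G|%:R)
                                 + ln #|G|%:R ^+ 2)) /\
    (1 - 4 / #|G|%:R) * #|G|%:R ^+ m <= (\sum_(s | good s) 1 : R).
Proof.
move=> m_gt0 G_gt1; set p : R := #|G|%:R.
have p_gt1 : 1 < p by rewrite ltr1n.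
have p_gt0 : 0 < p by exact: lt_trans p_gt1.
have L_gt0 : 0 < ln p by rewrite ln_gt0.
have [lam [mu [v [Z_step Z_small]]]] := exists_potential G m_gt0 L_gt0.
pose Z : seq G -> R := potential lam mu v.
pose a : R := expR (2 * ln p).
have aE : a = p ^+ 2 by rewrite /a expRM_natl lnK ?posrE.
exists (fun s => Z (catrev s [::]) < a); split => [s good_s d|].
  rewrite (@pairdev_perm R G s (catrev s [::])); last first.
    by rewrite perm_sym -/(rev s) perm_rev.
  by apply: Z_small => //; rewrite -/(rev s) size_rev size_tuple.
have Z_ge0 h : 0 <= Z h.
  by apply: sumr_ge0 => z _; rewrite !addr_ge0 // expR_ge0.
have := sum_potential_reaches_le (expR_ge0 (2 * ln p)) Z_ge0 Z_step
  (leqnn m : (size (@nil G) + m <= m)%N).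
rewrite /Z potential_nil -/Z -/a -/p => bad_le.
have bad_le4 : \sum_(s : m.-tuple G) (a <= Z (catrev s [::]))%R%:R
    <= 4 / p * p ^+ m.
  rewrite -(ler_pM2l (expR_gt0 (2 * ln p))) -/a; apply: le_trans bad_le _.
  by rewrite aE le_eqVlt; apply/orP; left; apply/eqP; field; rewrite gt_eqF.
have tot : \sum_(s : m.-tuple G) (a <= Z (catrev s [::]))%R%:R
    + \sum_(s : m.-tuple G | Z (catrev s [::]) < a) 1 = p ^+ m.
  rewrite [X in _ + X]big_mkcond -big_split /= -natrX -card_tuple -sum1_card.
  rewrite natr_sum; apply: eq_bigr => s _.
  by case: ltP => _; rewrite ?add0r ?addr0.
by rewrite mulrBl mul1r; move: tot bad_le4; lra.
Qed.

(** * The entries of the centred circulant matrix and of its Gram matrix *)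

Lemma residue_eqE (q : nat) (u l k : 'I_q.+1) :
  ((u%:Z == l%:Z - k%:Z %[mod q.+1%:Z])%Z) = (u == l - k).
Proof.
rewrite eqz_mod_dvd opprB addrA -eqz_mod_dvd -PoszD !modz_nat eqz_nat.
rewrite [RHS]eq_sym subr_eq [RHS]eq_sym -val_eqE /= (modn_small (ltn_ord l)).
by [].
Qed.

Lemma residue_countE (q m : nat) (s : m.-tuple 'I_q.+1) (l k : 'I_q.+1) :
  residue_count q.+1 (fun i => tnth s i) (l%:Z - k%:Z) = count_mem (l - k) s.
Proof.
rewrite -[in RHS](map_tnth_enum s) count_map -size_filter enumT.
rewrite /residue_count cardE /enum_mem; congr (size _).
by apply: eq_filter => i /=; rewrite -residue_eqE.
Qed.

(** The rank-one correction removes the mean [m/p] of the counts up to the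
    remainder [1/p].  Its squares add up to [1/p] in each entry of the Gram
    matrix, matching the [1/p] in the diagonal term of [pairdev]. *)
Lemma tildeAE (R : realType) (q m : nat) (s : m.-tuple 'I_q.+1)
    (j k : 'I_q.+1) : (0 < m)%N ->
  tildeA R q.+1 (fun i => tnth s i) j k
    = dev R s (j - k) / Num.sqrt m%:R + q.+1%:R^-1.
Proof.
move=> m_gt0; have r_gt0 : 0 < Num.sqrt m%:R :> R by rewrite sqrtr_gt0 ltr0n.
rewrite !mxE big_ord1 !mxE residue_countE /dev size_tuple card_ord mulr1.
have mE : m%:R = Num.sqrt m%:R ^+ 2 :> R by rewrite sqr_sqrtr.
set r := Num.sqrt m%:R in r_gt0 mE *; rewrite mE.
have : q.+1%:R != 0 :> R by rewrite pnatr_eq0.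
move: (q.+1%:R : R) => p p_neq0; by field; rewrite p_neq0 gt_eqF.
Qed.

Lemma tildeGE (R : realType) (q m : nat) (s : m.-tuple 'I_q.+1)
    (k l : 'I_q.+1) : (0 < m)%N ->
  (tildeG R q.+1 (fun i => tnth s i) - 1%:M) k l = pairdev R s (k - l) / m%:R.
Proof.
move=> m_gt0; set p : R := q.+1%:R.
have p_neq0 : p != 0 by rewrite pnatr_eq0.
have r_gt0 : 0 < Num.sqrt m%:R :> R by rewrite sqrtr_gt0 ltr0n.
have mE : m%:R = Num.sqrt m%:R ^+ 2 :> R by rewrite sqr_sqrtr.
have shift0 c : \sum_j dev R s (j - c) = 0.
  by rewrite (sum_shift (dev R s)) sum_dev.
have -> : (tildeG R q.+1 (fun i => tnth s i) - 1%:M) k l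
    = \sum_j dev R s (j - k) * dev R s (j - l) / m%:R
      + p^-1 - (k == l)%:R.
  rewrite !mxE; congr (_ - _).
  rewrite (eq_bigr (fun j => dev R s (j - k) * dev R s (j - l) / m%:R
      + (Num.sqrt m%:R)^-1 * p^-1 * (dev R s (j - k) + dev R s (j - l))
      + p^-1 ^+ 2)); last first.
    move=> j _; rewrite mxE !tildeAE // -/p.
    set r := Num.sqrt m%:R in r_gt0 mE *; rewrite mE.
    by clearbody p; field; rewrite p_neq0 gt_eqF.
  rewrite !big_split /= -mulr_sumr big_split /= !shift0 addr0 mulr0 addr0.
  by rewrite sum_cst card_ord expr2 mulrA divff // mul1r.
rewrite /pairdev card_ord size_tuple -/p subr_eq0 mulrBl mulrAC divff ?mul1r;
  last by rewrite pnatr_eq0 -lt0n.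
rewrite -mulr_suml (reindex_inj (addIr k)) /=.
rewrite (eq_bigr (fun z => dev R s z * dev R s (z + (k - l)))); last first.
  by move=> z _; rewrite addrK addrA.
by ring.
Qed.

(** * From almost orthonormal columns to a lower bound on the norm *)

Lemma sum_sqr_mx (R : realType) (n : nat) (x : 'cV[R]_n) :
  \sum_(i < n) x i ord0 ^+ 2 = (x^T *m x) ord0 ord0.
Proof. by rewrite mxE; apply: eq_bigr => i _; rewrite mxE expr2. Qed.

(** The quadratic form gives [|M x|^2 >= |x|_2^2 - b^2] with
    [b = sqrt c |x|_1]; when [b <= |x|_2], the right-hand side is at least
    [(|x|_2 - b)^2]. *)
Lemma l2norm_mulmx_ge (R : realType) (n p : nat) (M : 'M[R]_(n, p)) (c : R)
    (x : 'cV[R]_p) :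
  0 <= c -> (forall k l, `|(M^T *m M - 1%:M) k l| <= c) ->
  l2norm x - Num.sqrt c * l1norm x <= l2norm (M *m x).
Proof.
move=> c_ge0 Mc; pose D := M^T *m M - 1%:M.
have l1_ge0 : 0 <= l1norm x by apply: sumr_ge0.
have l2_ge0 : 0 <= l2norm x by apply: sqrtr_ge0.
have l2_sq : l2norm x ^+ 2 = \sum_i x i ord0 ^+ 2.
  by rewrite sqr_sqrtr // sumr_ge0 // => i _; rewrite sqr_ge0.
have D_ge : - (c * l1norm x ^+ 2) <= (x^T *m D *m x) ord0 ord0.
  suff : `|(x^T *m D *m x) ord0 ord0| <= c * l1norm x ^+ 2.
    by rewrite ler_norml => /andP[].
  rewrite mxE; apply: le_trans (ler_norm_sum _ _ _) _.
  rewrite expr2 {2}/l1norm !mulr_sumr; apply: ler_sum => l _.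
  rewrite normrM mulrA ler_wpM2r // mxE.
  apply: le_trans (ler_norm_sum _ _ _) _.
  rewrite /l1norm mulr_sumr; apply: ler_sum => k _.
  by rewrite mxE normrM mulrC ler_wpM2r.
have Mx_sq : l2norm x ^+ 2 - c * l1norm x ^+ 2
    <= \sum_i (M *m x) i ord0 ^+ 2.
  rewrite l2_sq !sum_sqr_mx trmx_mul mulmxA -(mulmxA x^T).
  have -> : M^T *m M = 1%:M + D by rewrite addrC subrK.
  rewrite mulmxDr mulmx1 mulmxDl [leRHS]mxE; lra.
have [lt|le] := ltP (l2norm x) (Num.sqrt c * l1norm x).
  by apply: le_trans (sqrtr_ge0 _); rewrite subr_le0 ltW.
rewrite -[leLHS]ger0_norm ?subr_ge0 // -sqrtr_sqr ler_wsqrtr //.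
apply: le_trans Mx_sq.
have -> : c * l1norm x ^+ 2 = (Num.sqrt c * l1norm x) ^+ 2.
  by rewrite exprMn sqr_sqrtr.
have b_ge0 : 0 <= Num.sqrt c * l1norm x by rewrite mulr_ge0 ?sqrtr_ge0.
have := ler_wpM2l b_ge0 le; rewrite !expr2; lra.
Qed.

(** * The law of the sample *)

Definition cylinder (R : realType) (d : measure_display) (T : measurableType d)
    (P : probability T R) (m n : nat) (U : 'I_m -> {RV P >-> nat})
    (s : m.-tuple 'I_n) : set T :=
  \bigcap_(i in [set` [set: 'I_m]%SET]) (U i @^-1` [set (tnth s i : nat)]).

Section Cylinders.
Context (R : realType) (d : measure_display) (T : measurableType d)
  (P : probability T R) (m n : nat) (U : 'I_m -> {RV P >-> nat}).
Implicit Type s : m.-tuple 'I_n.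

Lemma cylinderP s t : cylinder U s t -> forall i, U i t = tnth s i.
Proof. by move=> Ust i; apply: Ust => /=; rewrite finset.in_setT. Qed.

Lemma measurable_cylinder s : measurable (cylinder U s).
Proof.
apply: fin_bigcap_measurable => // i _.
by rewrite -[X in measurable X]setTI; exact: measurable_funP.
Qed.

Lemma trivIset_cylinder (D : set (m.-tuple 'I_n)) :
  trivIset D (cylinder U).
Proof.
move=> s1 s2 _ _ [t [/cylinderP s1t /cylinderP s2t]].
by apply: eq_from_tnth => i; apply: val_inj; rewrite /= -s1t -s2t.
Qed.

Lemma probability_cylinder s :
  mutually_independent U -> (forall i, uniform_residue n (U i)) ->
  P (cylinder U s) = ((n%:R^-1) ^+ m)%:E.
Proof.
move=> indU uniU; rewrite indU //.
rewrite (eq_bigr (fun=> (n%:R^-1)%:E)) => [|i _]; last first.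
  by rewrite uniU ltn_ord.
rewrite prodEFin; congr EFin.
by rewrite prodr_const cardsT card_ord.
Qed.

Lemma probability_bigcup_cylinder (good : pred (m.-tuple 'I_n)) :
  mutually_independent U -> (forall i, uniform_residue n (U i)) ->
  P (\bigcup_(s in [set` good]) cylinder U s)
    = ((\sum_(s | good s) 1) / n%:R ^+ m)%:E.
Proof.
move=> indU uniU; rewrite measure_fin_bigcup //; last 2 first.
- exact: trivIset_cylinder.
- by move=> s _; exact: measurable_cylinder.
have -> : [set` good] = [set` enum good].
  by apply/seteqP; split => s /=; rewrite mem_enum.
rewrite -fsbig_seq ?enum_uniq // big_enum /=.
under eq_bigr do rewrite probability_cylinder //.
rewrite sumEFin mulr_suml; congr EFin; apply: eq_bigr => s _.
by rewrite mul1r exprVn.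
Qed.


End Cylinders.

Unset Implicit Arguments.

(** * The theorem *)

Theorem proposition4 (R : realType) :
  exists kappa C : R, 0 < kappa /\ 0 < C /\
    forall p m : nat, (0 < p)%N -> (0 < m)%N ->
    forall (d : measure_display) (T : measurableType d) (P : probability T R)
      (U : 'I_m -> {RV P >-> nat}),
      mutually_independent U ->
      (forall i : 'I_m, uniform_residue p (U i)) ->
      exists E : set T,
        [/\ measurable E,
            ((1 - C / p%:R)%:E < P E)%E,
            forall t : T, E t -> forall k l : 'I_p,
              `|(tildeG R p (fun i => U i t) - 1%:M) k l| <= xi kappa p m
          & forall t : T, E t -> forall x : 'cV[R]_p,
              l2norm (tildeA R p (fun i => U i t) *m x)
                >= l2norm x - Num.sqrt (xi kappa p m) * l1norm x].
Proof.
exists 64, 5; do 2 split => //.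
case=> // q m _ m_gt0 d T P U indU uniU; set p := q.+1.
have p_gt0 : 0 < p%:R :> R by rewrite ltr0n.
have [p_lt5|p_ge5] := ltnP p 5.
  exists set0; split => //; rewrite measure0 lte_fin subr_lt0.
  by rewrite ltr_pdivlMr // mul1r ltr_nat.
have p_gt1 : (1 < #|'I_p|)%N by rewrite card_ord; apply: leq_trans p_ge5.
have [good [good_small good_many]] := most_tuples_small_pairdev R m_gt0 p_gt1.
rewrite card_ord in good_small good_many.
pose E := \bigcup_(s in [set` good]) cylinder U s.
have G_small t : E t -> forall k l : 'I_p,
    `|(tildeG R p (fun i => U i t) - 1%:M) k l| <= xi 64 p m.
  move=> [s /= good_s /cylinderP Ust] k l.
  have -> : (fun i => U i t) = (fun i => tnth s i : nat) by apply/funext.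
  rewrite tildeGE // normrM normfV [`|m%:R|]ger0_norm // ler_pdivrMr ?ltr0n //.
  apply: le_trans (good_small s good_s _) _.
  rewrite /xi le_eqVlt; apply/orP; left; apply/eqP.
  have : m%:R != 0 :> R by rewrite pnatr_eq0 -lt0n.
  move: (m%:R : R) (ln p%:R : R) => a L a_neq0.
  have : Num.sqrt p%:R != 0 :> R by rewrite gt_eqF // sqrtr_gt0.
  by move: (Num.sqrt _ : R) => r r_neq0; field; rewrite a_neq0.
have xi_ge0 : 0 <= xi (64 : R) p m.
  have L_ge0 : 0 <= ln p%:R :> R by rewrite ln_ge0 // ler1n.
  by rewrite /xi mulr_ge0 // addr_ge0 // divr_ge0 ?sqrtr_ge0 ?sqr_ge0.
exists E; split => //.
- apply: fin_bigcup_measurable => // s _; exact: measurable_cylinder.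
- rewrite /E probability_bigcup_cylinder // lte_fin.
  have pm_gt0 : 0 < p%:R ^+ m :> R by rewrite exprn_gt0.
  rewrite ltr_pdivlMr //; apply: lt_le_trans good_many.
  by rewrite ltr_pM2r // ltrD2l ltrN2 ltr_pM2r ?invr_gt0 // ltr_nat.
- by move=> t Et x; apply: l2norm_mulmx_ge => // k l; exact: G_small.
Qed.
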